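(* Let $n\in\mathbb{N}$. If $f\in C[0,1]$ is a (real-valued) convex function, then $$\sum_{i=0}^{n}\sum_{j=0}^{n}\left[ p_{n,i}(x)\,p_{n,j}(x)+p_{n,i}(y)\,p_{n,j}(y)-2\,p_{n,i}(x)\,p_{n,j}(y)\right] f\!\left(\frac{i+j}{2n}\right)\geq 0$$ for all $x,y\in[0,1]$.
   Context: $\mathbb{N}=\{1,2,3,\ldots\}$. For $n=0,1,2,\ldots$ and $\nu=0,1,\ldots,n$, the Bernstein basis polynomials are $p_{n,\nu}(x)=\binom{n}{\nu}x^{\nu}(1-x)^{n-\nu}$ (with the convention $0^0=1$). $C[0,1]$ denotes the continuous real-valued functions on $[0,1]$. *)

(* Defs.v *)
From HB Require Import structures.
From mathcomp Require Import all_boot all_order all_algebra.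
From mathcomp Require Import all_classical all_reals topology normedtype convex.

Set Implicit Arguments.
Unset Strict Implicit.
Unset Printing Implicit Defensive.

Import Order.TTheory GRing.Theory Num.Theory.
Import numFieldNormedType.Exports.

Local Open Scope ring_scope.

(* Since [x ^+ 0 = 1] for every [x], including [0], the convention [0^0 = 1]
   holds definitionally. *)
Definition bernstein (R : realType) (n nu : nat) (x : R) : R :=
  'C(n, nu)%:R * x ^+ nu * (1 - x) ^+ (n - nu).

(* Main.v *)
(* Grouping the double sum by k = i + j, the coefficient of f(k/2n) is that of
   'X^k in (A^n - B^n)^2, where A = (1 - x) + x 'X and B = (1 - y) + y 'X
   generate the Bernstein basis. Since A - B = (x - y)('X - 1), this polynomial
   is (x - y)^2 Q^2 ('X - 1)^2, where Q = \sum_l A^(n-1-l) B^l has nonnegative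
   coefficients, and multiplication by ('X - 1)^2 amounts to taking second
   differences of k |-> f(k/2n), which are nonnegative by convexity. *)
Require Import Defs.
From HB Require Import structures.
From mathcomp Require Import all_boot all_order all_algebra.
From mathcomp Require Import all_classical all_reals topology normedtype convex.
From mathcomp Require Import unstable interval_inference ring lra zify.

Set Implicit Arguments.
Unset Strict Implicit.
Unset Printing Implicit Defensive.

Import Order.TTheory GRing.Theory Num.Theory.
Import numFieldNormedType.Exports.

Local Open Scope classical_set_scope.
Local Open Scope ring_scope.

(** The linear functional on polynomials that sends ['X^k] to [g k]; it carries polynomial
    identities over to sums weighted by [g]. *)
Definition umbral (R : comNzRingType) (g : nat -> R) (p : {poly R}) : R :=
  \sum_(i < size p) p`_i * g i.

(** A bound [m] shared by two polynomials and their combination lets linearity be checked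
    coefficientwise. *)
Lemma umbral_wide (R : comNzRingType) (g : nat -> R) m (p : {poly R}) :
  (size p <= m)%N -> umbral g p = \sum_(i < m) p`_i * g i.
Proof.
move=> le_pm; rewrite /umbral (big_ord_widen m (fun i => p`_i * g i)) //.
rewrite big_mkcond; apply: eq_bigr => i _; case: ltnP => // le_pi.
by rewrite nth_default ?mul0r.
Qed.

Lemma umbral_is_linear (R : comNzRingType) (g : nat -> R) :
  linear_for *%R (umbral g).
Proof.
move=> a p q; set m := maxn (size p) (size q).
have szp : (size p <= m)%N by rewrite leq_maxl.
have szq : (size q <= m)%N by rewrite leq_maxr.
have szpq : (size (a *: p + q)%R <= m)%N.
  rewrite (leq_trans (size_polyD _ _)) // geq_max szq andbT.
  exact: leq_trans (size_scale_leq _ _) szp.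
rewrite !(@umbral_wide _ g m) // big_distrr -big_split; apply: eq_bigr => i _.
by rewrite coefD coefZ mulrDl -mulrA.
Qed.

HB.instance Definition _ (R : comNzRingType) (g : nat -> R) :=
  GRing.isLinear.Build R {poly R} R *%R (umbral g) (umbral_is_linear g).

Lemma umbralXn (R : comNzRingType) (g : nat -> R) n : umbral g 'X^n = g n.
Proof.
rewrite /umbral size_polyXn big_ord_recr /= coefXn eqxx mul1r big1 ?add0r //.
by move=> i _; rewrite coefXn ltn_eqF ?mul0r.
Qed.

Lemma umbralM_sum (R : comNzRingType) (g a b : nat -> R) m n :
  umbral g ((\sum_(0 <= i < m) a i *: 'X^i) * (\sum_(0 <= j < n) b j *: 'X^j)) =
  \sum_(0 <= i < m) \sum_(0 <= j < n) a i * b j * g (i + j)%N.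
Proof.
rewrite mulr_suml raddf_sum; apply: eq_bigr => i _.
rewrite mulr_sumr raddf_sum; apply: eq_bigr => j _ /=.
by rewrite -scalerAl -scalerAr scalerA -exprD linearZ /= umbralXn.
Qed.

(** By linearity monomials suffice: ['X^i * ('X - 1) ^+ 2] is sent to the second difference of [g]
    at [i]. Only [i < size p] occur, so [g] need be convex only in the range fixed by [N]. *)
Lemma umbral_second_difference_ge0 (R : realDomainType) (g : nat -> R) N
    (p : {poly R}) :
  (size p <= N)%N -> (forall i, 0 <= p`_i) ->
  (forall k, (k < N)%N -> 0 <= g k.+2 - 2 * g k.+1 + g k) ->
  0 <= umbral g (p * ('X - 1) ^+ 2).
Proof.
move=> szp p_ge0 g_convex.
rewrite -[p in p * _](coefK p) poly_def mulr_suml raddf_sum.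
apply: sumr_ge0 => i _; rewrite -scalerAl /= linearZ mulr_ge0 //=.
have -> : 'X^i * ('X - 1) ^+ 2 = 'X^(i.+2) - 2 *: 'X^(i.+1) + 'X^i :> {poly R}.
  by rewrite scaler_nat !exprS; ring.
rewrite raddfD raddfB /= linearZ /= !umbralXn g_convex //.
exact: leq_trans (ltn_ord i) szp.
Qed.

(** The binomial theorem, read coefficient by coefficient in ['X]. *)
Lemma bernstein_genfun (R : realType) n (x : R) :
  \sum_(0 <= i < n.+1) bernstein n i x *: 'X^i = ((1 - x)%:P + x *: 'X) ^+ n.
Proof.
rewrite exprDn big_mkord; apply: eq_bigr => i _.
rewrite exprZn -polyC_exp mul_polyC scalerA -scaler_nat scalerA /bernstein.
by congr (_ *: _); ring.
Qed.

Lemma convex_function_midpoint (R : realFieldType) (D : set R^o) (f : R -> R)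
    (a b : R) :
  convex_function D f -> a \in D -> b \in D ->
  f ((a + b) / 2) <= (f a + f b) / 2.
Proof.
move=> f_convex aD bD.
have [half_ge0 half_le1] : 0 <= (2^-1 : R) /\ (2^-1 : R) <= 1 by lra.
have := f_convex (Itv01 half_ge0 half_le1) _ _ aD bD; rewrite !convRE.
have mid (u v : R) : (u + v) / 2 = 2^-1 * u + onem 2^-1 * v by rewrite /onem; lra.
by rewrite !mid.
Qed.

(** The middle node is the midpoint of its two neighbours, and [k.+2 <= m] keeps all three in
    [0, 1]. *)
Lemma convex_second_difference_ge0 (R : realType) (f : R -> R) (m k : nat) :
  convex_function (`[0, 1]%classic : set R^o) f -> (k.+2 <= m)%N ->
  0 <= f (k.+2%:R / m%:R) - 2 * f (k.+1%:R / m%:R) + f (k%:R / m%:R).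
Proof.
move=> f_convex le_km.
have m_gt0 : 0 < m%:R :> R by rewrite ltr0n; apply: leq_trans le_km.
have in01 j : (j <= m)%N -> (j%:R / m%:R : R^o) \in (`[0, 1]%classic : set R^o).
  move=> le_jm; rewrite inE /= in_itv /= divr_ge0 ?ler0n //=.
  by rewrite ler_pdivrMr // mul1r ler_nat.
have := convex_function_midpoint f_convex (in01 _ le_km)
  (in01 k (ltnW (ltnW le_km))).
have -> : (k.+2%:R / m%:R + k%:R / m%:R) / 2 = k.+1%:R / m%:R :> R.
  by rewrite -!natr1; field; exact: lt0r_neq0.
by lra.
Qed.

Theorem theorem1 (R : realType) (n : nat) (n_ge1 : (1 <= n)%N) (f : R -> R)
    (f_cont : {within `[0, 1], continuous f})
    (f_convex : convex_function (`[0, 1]%classic : set R^o) f)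
    (x y : R) (x01 : x \in `[0, 1]) (y01 : y \in `[0, 1]) :
  0 <= \sum_(0 <= i < n.+1) \sum_(0 <= j < n.+1)
    (bernstein n i x * bernstein n j x + bernstein n i y * bernstein n j y
       - 2 * bernstein n i x * bernstein n j y) * f ((i + j)%:R / (2 * n)%:R).
Proof.
pose g k : R := f (k%:R / (2 * n)%:R).
(* The qualifier [Num.nneg] would hide the closure instances under [polyOver]. *)
pose nneg := GRing.SemiringClosed.clone R (@Num.Def.nneg_num_pred R) _.
pose A (z : R) : {poly R} := (1 - z)%:P + z *: 'X.
(* The range of [x] and [y] enters here: both coefficients, [1 - z] and [z], must be nonnegative. *)
have A_ge0 z : z \in `[0, 1] -> A z \is a polyOver nneg.
  rewrite in_itv /= => /andP[z_ge0 z_le1]; apply: rpredD.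
    by rewrite polyOverC nnegrE subr_ge0.
  by rewrite polyOverZ ?polyOverX.
have szA z : (size (A z) <= 2)%N.
  rewrite (leq_trans (size_polyD _ _)) // geq_max (leq_trans (size_polyC_leq1 _)) //.
  by rewrite (leq_trans (size_scale_leq _ _)) ?size_polyX.
(* The cofactor of [A x - A y] in [A x ^+ n - A y ^+ n]. *)
pose Q := \sum_(l < n) A x ^+ (n.-1 - l) * A y ^+ l.
have Q_ge0 : Q \is a polyOver nneg.
  by apply: rpred_sum => l _; rewrite rpredM ?rpredX ?A_ge0.
have szAX z k : (size (A z ^+ k)%R <= k.+1)%N.
  rewrite (leq_trans (size_poly_exp_leq _ _)) // ltnS.
  by move: (szA z); case: (size _) => [|[|[|?]]] // _; rewrite ?mul0n ?mul1n.
have szQ : (size Q <= n)%N.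
  apply: (leq_trans (size_sum _ _ _)); apply/bigmax_leqP => l _.
  apply: (leq_trans (size_polyMleq _ _)).
  have := leq_add (szAX x (n.-1 - l)%N) (szAX y l).
  have := ltn_ord l; lia.
have AB : (A x ^+ n - A y ^+ n) ^+ 2 = (x - y) ^+ 2 *: (Q ^+ 2 * ('X - 1) ^+ 2).
  have -> : A x ^+ n - A y ^+ n = (x - y) *: ('X - 1) * Q.
    rewrite subrXX; congr (_ * _); rewrite /A -!mul_polyC !rmorphB /=; ring.
  by rewrite -!mul_polyC rmorphXn /=; ring.
have sqAB : umbral g ((A x ^+ n - A y ^+ n) ^+ 2) =
    umbral g (A x ^+ n * A x ^+ n) + umbral g (A y ^+ n * A y ^+ n)
      - 2 * umbral g (A x ^+ n * A y ^+ n).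
  by rewrite sqrrB raddfD raddfB raddfMn /= !expr2 -mulr_natl; ring.
suff : 0 <= umbral g ((A x ^+ n - A y ^+ n) ^+ 2).
  (* The three products become double sums over the same range, which merge term by term. *)
  rewrite sqAB -!bernstein_genfun !umbralM_sum mulr_sumr -big_split -sumrB /=.
  congr (0 <= _); apply: eq_bigr => i _.
  rewrite mulr_sumr -big_split -sumrB; apply: eq_bigr => j _ /=.
  by rewrite /g; ring.
rewrite AB linearZ mulr_ge0 ?sqr_ge0 //=.
(* [Q ^+ 2] has size at most [2n - 1], and [k < 2n - 1] means [k.+2 <= 2n], so no second difference
   reaches past the node 1. *)
apply: (@umbral_second_difference_ge0 _ g (2 * n).-1).
- by rewrite (leq_trans (size_polyMleq _ _)) // mul2n -addnn -!subn1 leq_sub2r ?leq_add.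
- by move=> i; move/polyOverP: (rpredX 2 Q_ge0) => /(_ i).
- move=> k lt_k; apply: convex_second_difference_ge0 => //; lia.
Qed.
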